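(* Let $U$ be an $\mathbb{F}_q$-subspace of $V=\mathbb{F}_{q^n}^r$ with $\dim_{\mathbb{F}_q}U=rn-n$, and let $F_U\in\mathbb{F}_{q^n}[x_0,\dots,x_{r-1}]$ be its determinantal polynomial. If $P\in L_U$ has weight $k\ge 2$, then $P$ is a singular point of the hypersurface $F_U=0$ of multiplicity exactly $1+q+\dots+q^{k-1}$ (i.e. in affine coordinates centred at $P$ the lowest-degree nonzero homogeneous component of $F_U$ has degree $1+q+\dots+q^{k-1}$).
   Context: $q$ a prime power, $n,r\ge 2$, $V=\mathbb{F}_{q^n}^r$. For an $\mathbb{F}_q$-subspace $U$, $L_U=\{\langle u\rangle_{\mathbb{F}_{q^n}}:u\in U\setminus\{0\}\}\subseteq\mathrm{PG}(r-1,q^n)$, and the weight of $P=\langle v\rangle_{\mathbb{F}_{q^n}}$ is $w_{L_U}(P)=\dim_{\mathbb{F}_q}(\langle v\rangle_{\mathbb{F}_{q^n}}\cap U)$. Determinantal polynomial: for $u=(u_0,\dots,u_{r-1})\in V$ let $\hat u=(u_0,\dots,u_{r-1},u_0^q,\dots,u_{r-1}^q,\dots,u_0^{q^{n-1}},\dots,u_{r-1}^{q^{n-1}})\in\mathbb{F}_{q^n}^{rn}$. If $\dim_{\mathbb{F}_q}U=rn-n$ with $\mathbb{F}_q$-basis $u_1,\dots,u_{rn-n}$, $F_U(x_0,\dots,x_{r-1})$ is the determinant of the $rn\times rn$ matrix whose first $rn-n$ rows are $\hat u_1,\dots,\hat u_{rn-n}$ and whose remaining $n$ rows are, for $i=0,\dots,n-1$,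 the vector having $x_0^{q^i},\dots,x_{r-1}^{q^i}$ in positions $ir,\dots,ir+r-1$ and zeros elsewhere. $F_U$ is a nonzero homogeneous polynomial of degree $1+q+\dots+q^{n-1}$, determined by $U$ up to a nonzero scalar, whose zeros in $\mathrm{PG}(r-1,q^n)$ are exactly the points of $L_U$. *)

(* Defs.v *)
From HB Require Import structures.
From mathcomp Require Import all_boot all_order all_algebra all_field.
From mathcomp Require Import mpoly.
Set Implicit Arguments. Unset Strict Implicit. Unset Printing Implicit Defensive.
Import GRing.Theory.
Local Open Scope ring_scope.

(* L plays the role of F_{q^n}; F_q is the subfield {x | x^q = x}. *)
Definition inFq (L : finFieldType) (q : nat) (x : L) : bool := x ^+ q == x.

Definition Fq_indep (L : finFieldType) (q r m : nat) (b : 'I_m -> 'rV[L]_r) : Prop :=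
  forall c : 'I_m -> L, (forall i, inFq q (c i)) ->
    \sum_(i < m) c i *: b i = 0 -> forall i, c i = 0.

Definition Fq_span (L : finFieldType) (q r m : nat) (b : 'I_m -> 'rV[L]_r)
    (u : 'rV[L]_r) : Prop :=
  exists c : 'I_m -> L, (forall i, inFq q (c i)) /\ u = \sum_(i < m) c i *: b i.

Definition Fq_dim_eq (L : finFieldType) (q r : nat) (W : 'rV[L]_r -> Prop) (k : nat) : Prop :=
  exists w : 'I_k -> 'rV[L]_r,
    (forall i, W (w i)) /\ Fq_indep q w /\ (forall u, W u <-> Fq_span q w u).

(* weight of P = <v>_{F_{q^n}} w.r.t. L_U, U = F_q-span of b:
   dim_{F_q}(<v> ∩ U) = k *)
Definition weight (L : finFieldType) (q r m : nat) (b : 'I_m -> 'rV[L]_r)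
    (v : 'rV[L]_r) (k : nat) : Prop :=
  Fq_dim_eq q (fun u => (exists a : L, u = a *: v) /\ Fq_span q b u) k.

(* \hat u, entry at column c = i*r + j : u_j^(q^i) *)
Definition hatv (L : finFieldType) (q r n : nat) (u : 'rV[L]_r) (c : nat) : L :=
  \sum_(i < n) \sum_(j < r | c == (i * r + j)%N) u 0 j ^+ (q ^ i).

Definition detpoly (L : finFieldType) (q n r : nat) (b : 'I_(r * n - n) -> 'rV[L]_r)
  : {mpoly L[r]} :=
  \det (col_mx
    (\matrix_(a < r * n - n, c < r * n - n + n) (hatv q n (b a) c)%:MP)
    (\matrix_(i < n, c < r * n - n + n)
        \sum_(j < r | (c : nat) == (i * r + j)%N) 'X_j ^+ (q ^ i))).

(* Multiplicity of the hypersurface p = 0 at the point P = <v> (v_{i0} <> 0):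
   in the affine chart x_{i0} = 1 with coordinates centred at P
   (x_j = y_j + v_j / v_{i0}), the lowest-degree nonzero homogeneous
   component of p has degree m. *)
Definition mult_at (L : finFieldType) (r : nat) (p : {mpoly L[r]})
    (v : 'rV[L]_r) (i0 : 'I_r) (m : nat) : Prop :=
  let w := (v 0 i0)^-1 *: v in
  let g := p \mPo [tuple (if j == i0 then 1 else 'X_j + (w 0 j)%:MP) | j < r] in
  (exists mo, mo \in msupp g /\ mdeg mo = m) /\
  (forall mo, mo \in msupp g -> (m <= mdeg mo)%N).

(* Main.v *)
(** Let [U] be the F_q-span of [b] and [a_1, ..., a_n] an F_q-basis of its orthogonal
    for the trace form.  The matrix of F_U times an invertible constant matrix is block
    triangular, with the Moore matrix of the linear forms [a_l . x] as a diagonal block;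
    hence F_U is, up to a nonzero scalar, the Moore determinant of these forms.
    The F_q-relations among the values [a_l . v] form a space of dimension [k], the weight
    of [<v>], so the basis can be chosen with [a_l . v = 0] for [l < k] and the other
    values F_q-independent.  Expanding at [v], the lowest-degree component is then the
    Moore determinant of [k] independent linear forms, of degree [1 + q + ... + q^(k-1)],
    times a nonzero constant.  The bases come from Galois descent for the semilinear map
    combining the Frobenius with a cyclic shift of the coordinates. *)

Require Import Defs.
From HB Require Import structures.
From mathcomp Require Import all_boot all_order all_algebra all_field.
From mathcomp Require Import mpoly fraction zify.
Set Implicit Arguments. Unset Strict Implicit. Unset Printing Implicit Defensive.
Import GRing.Theory.
Local Open Scope ring_scope.

(** * Powers of [q] and the Frobenius of a finite field *)

Lemma exprn_sum_pchar (R : comNzRingType) (Q : nat) I (s : seq I) (P : pred I)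
    (F : I -> R) :
  [pchar R].-nat Q -> (\sum_(i <- s | P i) F i) ^+ Q = \sum_(i <- s | P i) F i ^+ Q.
Proof.
move=> pQ; apply: (big_morph (fun x => x ^+ Q)) => [x y|]; first exact: exprDn_pchar.
by rewrite expr0n gtn_eqF //; case/andP: pQ.
Qed.

Lemma exprn_fixed (R : pzSemiRingType) (q : nat) (x : R) :
  x ^+ q = x -> forall i, x ^+ (q ^ i) = x.
Proof. by move=> xq; elim=> [|i IHi]; rewrite ?expr1 // expnSr exprM IHi. Qed.

Lemma pnat_fmorph (F : fieldType) (R : nzRingType) (f : {rmorphism F -> R}) (m : nat) :
  [pchar F].-nat m -> [pchar R].-nat m.
Proof. by move=> Fm; rewrite (eq_pnat _ (fmorph_pchar f)). Qed.

Section FiniteField.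

Variables (L : finFieldType) (q n : nat).
Hypotheses (q_gt1 : (1 < q)%N) (cardL : #|L| = (q ^ n)%N).

Lemma degree_gt0 : (0 < n)%N.
Proof.
by rewrite lt0n; apply: contraTneq (finNzRing_gt1 L) => n0; rewrite cardL n0.
Qed.

Lemma pchar_q : [pchar L].-nat q.
Proof.
have [p pr_p pL] := finPcharP L; rewrite (eq_pnat _ (pcharf_eq pL)).
have : p.-nat (q ^ n)%N by rewrite -cardL (card_pprimeChar pL) pnatX pnat_id.
by rewrite pnatX gtn_eqF ?degree_gt0 // orbF.
Qed.

Lemma pchar_qX i : [pchar L].-nat (q ^ i)%N.
Proof. by rewrite pnatX pchar_q. Qed.

Lemma exprq_sum i I (s : seq I) (P : pred I) (F : I -> L) :
  (\sum_(j <- s | P j) F j) ^+ (q ^ i) = \sum_(j <- s | P j) F j ^+ (q ^ i).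
Proof. exact/exprn_sum_pchar/pchar_qX. Qed.

Lemma exprqn (x : L) : x ^+ (q ^ n) = x.
Proof. by rewrite -cardL expf_card. Qed.

(* The fixed field of the Frobenius of an extension K is no larger than that of
   L: 'X^q - 'X divides 'X^#|L| - 'X, hence splits over L. *)
Lemma Frobenius_fixed_fmorph (K : fieldType) (f : {rmorphism L -> K}) (c : K) :
  c ^+ q = c -> exists2 x : L, x ^+ q = x & c = f x.
Proof.
move=> cq.
have dvd : ('X^q - 'X : {poly L}) %| \prod_(x <- enum L) ('X - x%:P).
  rewrite big_enum -finField_genPoly cardL.
  elim: n => [|m IHm]; first by rewrite expr1 subrr dvdp0.
  (* In characteristic p, ['X^(q^m.+1) - 'X] is [('X^(q^m) - 'X)^q + ('X^q - 'X)]. *)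
  rewrite expnSr exprM -['X^(q ^ m) ^+ q](subrK 'X^q) -addrA dvdp_add //.
  have pqX : [pchar {poly L}].-nat q by apply: (pnat_fmorph polyC); apply: pchar_q.
  have -> : ('X^(q ^ m) ^+ q - 'X^q : {poly L}) = ('X^(q ^ m) - 'X) ^+ q.
    by rewrite exprDn_pchar // exprNn_pchar.
  by rewrite (dvdp_trans IHm) // dvdp_exp // (ltn_trans _ q_gt1).
(* A divisor of a product of linear factors is associate to a subproduct, so each root of its image
   under [f] is some [f x]. *)
have [m /eqp_dvdl dm] := dvdp_prod_XsubC dvd.
have : root (map_poly f (\prod_(x <- mask m (enum L)) ('X - x%:P))) c.
  have : map_poly f ('X^q - 'X) %| map_poly f (\prod_(x <- mask m (enum L)) ('X - x%:P)).
    by rewrite dvdp_map dm dvdpp.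
  rewrite -dvdp_XsubCl; apply: dvdp_trans; rewrite dvdp_XsubCl.
  by rewrite rmorphB /= map_polyXn map_polyX rootE !hornerE cq subrr.
rewrite rmorph_prod /=; under eq_bigr do rewrite rmorphB /= map_polyX map_polyC.
rewrite -(big_map f predT (fun y => 'X - y%:P)) root_prod_XsubC => /mapP[x _ cx].
by exists x => //; apply: (fmorph_inj f); rewrite rmorphXn -cx.
Qed.

(** * Galois descent *)

Section Descent.

Variable N : nat.

(** A [q]-semilinear map. When [iter n pi] is the identity, so is [iter n (tau pi)]: this is an
    action of the cyclic Galois group of [L] over F_q, to which descent applies. *)
Definition tau (pi : 'I_N -> 'I_N) (w : 'rV[L]_N) : 'rV[L]_N :=
  \row_c w 0 (pi c) ^+ q.

Variable pi : 'I_N -> 'I_N.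
Hypothesis pi_n : iter n pi =1 id.

Lemma tau_sum I (s : seq I) (P : pred I) (F : I -> 'rV[L]_N) :
  tau pi (\sum_(j <- s | P j) F j) = \sum_(j <- s | P j) tau pi (F j).
Proof.
apply/rowP=> c; rewrite !mxE !summxE -[q]expn1 exprq_sum.
by apply: eq_bigr => j _; rewrite !mxE expn1.
Qed.

Lemma tauZ a w : tau pi (a *: w) = a ^+ q *: tau pi w.
Proof. by apply/rowP=> c; rewrite !mxE exprMn. Qed.

Lemma iter_tauZ i a w : iter i (tau pi) (a *: w) = a ^+ (q ^ i) *: iter i (tau pi) w.
Proof.
elim: i => [|i IHi]; first by rewrite expr1.
by rewrite !iterS IHi tauZ -exprM -expnSr.
Qed.

Lemma iter_tau i w c : iter i (tau pi) w 0 c = w 0 (iter i pi c) ^+ (q ^ i).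
Proof.
elim: i c => [|i IHi] c; first by rewrite expr1.
by rewrite iterS mxE IHi -iterSr -exprM -expnSr.
Qed.

Lemma tau_n w : iter n (tau pi) w = w.
Proof. by apply/rowP=> c; rewrite iter_tau pi_n exprqn. Qed.

Lemma pi_inj : injective pi.
Proof.
apply: (can_inj (g := iter n.-1 pi)) => c.
by rewrite -iterSr (prednK degree_gt0) pi_n.
Qed.

Lemma tau_trace w : tau pi (\sum_(i < n) iter i (tau pi) w) = \sum_(i < n) iter i (tau pi) w.
Proof.
rewrite tau_sum; move: (tau_n w); case: n => [|m] tm; first by rewrite !big_ord0.
by rewrite big_ord_recr big_ord_recl /= -iterS tm addrC.
Qed.

(* If [phi] vanished on all traces of multiples [a *: w], the polynomial
   [\sum_i phi (tau^i w) 'X^(q^i)] of degree < #|L| would have #|L| roots. *)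
Lemma exists_tau_fixed m m0 (A : 'M[L]_(m, N)) (F0 : 'M[L]_(m0, N)) :
  (forall w : 'rV_N, (w <= A)%MS -> (tau pi w <= A)%MS) -> ~~ (A <= F0)%MS ->
  exists f : 'rV[L]_N, [/\ tau pi f = f, (f <= A)%MS & ~~ (f <= F0)%MS].
Proof.
move=> stabA /row_subPn[i0]; set w := row i0 A => nwF.
have wA : (w <= A)%MS by apply: row_sub.
have twA i : (iter i (tau pi) w <= A)%MS by elim: i => //= i IHi; apply: stabA.
have [j phi_w] : exists j, (w *m cokermx F0) 0 j != 0.
  apply/existsP; rewrite -negb_forall; apply: contra nwF => /forallP w0.
  by rewrite submxE; apply/eqP/rowP=> j; rewrite [RHS]mxE; apply/eqP.
(* A linear form that vanishes on the rows of [F0] but not at [w]. *)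
pose phi (x : 'rV[L]_N) := (x *m cokermx F0) 0 j.
pose P := \sum_(i < n) phi (iter i (tau pi) w) *: 'X^(q ^ i).
have P1 : P`_1 = phi w.
  rewrite coef_sum (bigD1 (Ordinal degree_gt0)) //= coefZ coefXn mulr1 big1 ?addr0 // => i ni.
  rewrite coefZ coefXn (_ : (1 == q ^ i)%N = false) ?mulr0 //.
  apply: contraNF ni; rewrite -{1}(expn0 q) eqn_exp2l // => /eqP i_0.
  exact/eqP/val_inj.
have Pn0 : P != 0 by apply: contraNneq phi_w => P0; rewrite -/(phi w) -P1 P0 coef0.
have szP : (size P <= #|L|)%N.
  rewrite cardL; apply: (leq_trans (size_sum _ _ _)); apply/bigmax_leqP=> i _.
  by rewrite (leq_trans (size_scale_leq _ _)) // size_polyXn ltn_exp2l.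
have [a nPa] : exists a, ~~ root P a.
  apply/existsP; rewrite -negb_forall; apply: contraTN szP => /forallP rP.
  rewrite -ltnNge cardE; apply: max_poly_roots => //; last exact: enum_uniq.
  by apply/allP=> x _; apply: rP.
(* The form [phi] takes the value [P.[a]] at this trace. *)
exists (\sum_(i < n) iter i (tau pi) (a *: w)); split; first exact: tau_trace.
  by apply: summx_sub => i _; rewrite iter_tauZ scalemx_sub.
apply: contra nPa; rewrite submxE => /eqP F0f; rewrite rootE horner_sum.
have phif : phi (\sum_(i < n) iter i (tau pi) (a *: w)) = 0 by rewrite /phi F0f mxE.
apply/eqP; rewrite -[RHS]phif /phi mulmx_suml summxE; apply: eq_bigr => i _.
by rewrite iter_tauZ -scalemxAl [RHS]mxE hornerZ hornerXn mulrC.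
Qed.

(** While the rank of [F0] is below that of [A], some fixed vector of [A] lies outside [F0]; such
    vectors are adjoined one at a time. *)
Lemma tau_fixed_basis_extend m (A : 'M[L]_(m, N)) s m0 (F0 : 'M[L]_(m0, N)) :
  (forall w : 'rV_N, (w <= A)%MS -> (tau pi w <= A)%MS) ->
  (F0 <= A)%MS -> row_free F0 -> \rank A = (m0 + s)%N ->
  exists F1 : 'M[L]_(s, N), [/\ forall i, tau pi (row i F1) = row i F1,
    row_free (col_mx F0 F1) & (col_mx F0 F1 <= A)%MS].
Proof.
move=> stabA; elim: s m0 F0 => [|s IHs] m0 F0 F0A freeF rA.
  exists 0; split; first by case.
    by rewrite /row_free -addsmxE addsmx0 (eqP freeF) addn0.
  by rewrite col_mx_sub F0A sub0mx.
have [|f [tf fA fF]] := @exists_tau_fixed _ _ A F0 stabA.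
  by apply/negP=> /mxrankS; rewrite rA (eqP freeF) addnS ltnNge leq_addr.
have [|||F1 [tF1 free1 sub1]] := IHs _ (col_mx F0 f).
- by rewrite col_mx_sub F0A.
- rewrite /row_free eqn_leq rank_leq_row /= -addsmxE [leqLHS]addn1 -{1}(eqP freeF).
  apply: rank_ltmx; rewrite /ltmx addsmxSl; apply: contra fF => /(submx_trans _); apply.
  exact: addsmxSr.
- by rewrite -addnA.
exists (col_mx f F1); split.
- suff tfF : forall i : 'I_(1 + s), tau pi (row i (col_mx f F1)) = row i (col_mx f F1).
    exact: tfF.
  move=> i; case: (split_ordP i) => j ->; last by rewrite rowKd.
  by rewrite rowKu [j]ord1 row_id.
- rewrite /row_free -addsmxE (adds_eqmx (eqmx_refl F0) (eqmx_sym (addsmxE f F1))).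
  rewrite addsmxA (adds_eqmx (addsmxE F0 f) (eqmx_refl F1)) addsmxE.
  by rewrite (eqP free1) -addnA.
- have fF1 : (col_mx f F1 <= A)%MS.
    by rewrite col_mx_sub fA; move: sub1; rewrite col_mx_sub => /andP[].
  by rewrite col_mx_sub F0A; exact: fF1.
Qed.

Lemma tau_fixed_basis m (A : 'M[L]_(m, N)) s :
  (forall w : 'rV_N, (w <= A)%MS -> (tau pi w <= A)%MS) -> \rank A = s ->
  exists F : 'M[L]_(s, N), [/\ forall i, tau pi (row i F) = row i F,
    row_free F & (F <= A)%MS].
Proof.
move=> stabA rA; have [|||F [tF freeF subF]] := @tau_fixed_basis_extend _ A s 0 0 stabA.
- exact: sub0mx.
- by rewrite /row_free mxrank0.
- by rewrite add0n.
exists F; split=> //; last by move: subF; rewrite col_mx_sub => /andP[].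
by move: freeF; rewrite /row_free -addsmxE adds0mx.
Qed.

End Descent.

(** For bijective [rho] this gives [tau rho w *m Y = tau pi (w *m Y)], so the left kernel of [Y] is
    stable under [tau rho]. *)
Definition equivariant N N' (rho : 'I_N -> 'I_N) (pi : 'I_N' -> 'I_N') (Y : 'M[L]_(N, N')) :=
  forall i c, Y i c = Y (rho i) (pi c) ^+ q.

Lemma kermx_tau N N' rho pi (Y : 'M[L]_(N, N')) (w : 'rV_N) :
  iter n rho =1 id -> equivariant rho pi Y ->
  (w <= kermx Y)%MS -> (tau rho w <= kermx Y)%MS.
Proof.
move=> rho_n eqY /sub_kermxP wY; apply/sub_kermxP/rowP=> c; rewrite !mxE.
transitivity ((w *m Y) 0 (pi c) ^+ q); last first.
  by rewrite wY mxE expr0n gtn_eqF // (ltn_trans _ q_gt1).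
rewrite mxE [X in _ = X ^+ _](reindex_inj (pi_inj rho_n)) -[q in RHS]expn1 exprq_sum expn1.
by apply: eq_bigr => i _; rewrite mxE exprMn eqY.
Qed.

Lemma iter_id m T : iter m id =1 (id : T -> T).
Proof. by move=> x; elim: m. Qed.

(** The left kernel of [W] is stable under the coordinatewise Frobenius, hence has a basis over F_q;
    each basis vector is an F_q-relation between the rows, so it is zero. *)
Lemma row_free_tau_fixed N pi m (W : 'M[L]_(m, N)) :
  (forall i, tau pi (row i W) = row i W) ->
  (forall d : 'rV[L]_m, (forall i, inFq q (d 0 i)) -> d *m W = 0 -> d = 0) ->
  row_free W.
Proof.
move=> tW indep.
have eqW : equivariant id pi W by move=> i c; have /rowP/(_ c) := tW i; rewrite !mxE.
have stab := fun w => @kermx_tau _ _ id pi W w (@iter_id n _) eqW.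
have [F [tF freeF subF]] := tau_fixed_basis (@iter_id n _) stab erefl.
rewrite -kermx_eq0 -mxrank_eq0 -(eqP freeF) mxrank_eq0; apply/eqP/row_matrixP=> i.
rewrite row0; apply: indep => [j|].
  by rewrite /inFq; have /rowP/(_ j) := tF i; rewrite !mxE => ->.
by apply/sub_kermxP/(submx_trans _ subF)/row_sub.
Qed.

End FiniteField.

(** * Moore determinants *)

Section Moore.

Variables (K : fieldType) (q : nat).
Hypothesis qK : [pchar K].-nat q.

Let q_gt0 : (0 < q)%N. Proof. by case/andP: qK. Qed.

(** F_q is replaced by the fixed field of [x |-> x^q], so that [K] may be infinite, such as a field
    of rational fractions. *)
Definition Frobenius_indep k (z : 'I_k -> K) :=
  forall c : 'I_k -> K, (forall i, c i ^+ q = c i) ->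
    \sum_(i < k) c i * z i = 0 -> forall i, c i = 0.

Lemma Frobenius_indep_expr k (z : 'I_k -> K) :
  Frobenius_indep z -> Frobenius_indep (fun i => z i ^+ q).
Proof.
move=> indz c cq cz; apply: indz => //; apply/eqP.
suff : (\sum_(i < k) c i * z i) ^+ q == 0 by rewrite expf_eq0 q_gt0.
by rewrite exprn_sum_pchar // -[X in _ == X]cz; apply/eqP/eq_bigr=> i _; rewrite exprMn cq.
Qed.

Lemma Frobenius_indep_lift k (z : 'I_k.+1 -> K) :
  Frobenius_indep z -> Frobenius_indep (fun i => z (lift ord0 i)).
Proof.
move=> indz c cq cz i; pose c' j := oapp c 0 (unlift ord0 j).
have c'l j : c' (lift ord0 j) = c j by rewrite /c' liftK.
have c'0 : c' ord0 = 0 by rewrite /c' unlift_none.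
rewrite -c'l; apply: indz => [j|].
  rewrite /c'; case: unliftP => //= _; rewrite expr0n gtn_eqF //.
by rewrite big_ord_recl c'0 mul0r add0r; under eq_bigr do rewrite c'l.
Qed.

(* Normalise the relation at [ord0]; subtracting it from its image under the
   Frobenius kills that term and leaves a shorter relation among the [z i ^+ q]. *)
Lemma moore_relation k (z d : 'I_k -> K) :
  Frobenius_indep z ->
  (forall i, (i < k)%N -> \sum_(l < k) d l * z l ^+ (q ^ i) = 0) ->
  forall l, d l = 0.
Proof.
elim: k z d => [|k IHk] z d indz dz; first by case.
have [d0|d0] := eqVneq (d ord0) 0.
  have dl := IHk _ (fun l => d (lift ord0 l)) (Frobenius_indep_lift indz).
  move=> l; case: (unliftP ord0 l) => [j|] -> //; apply: dl => i ik.
  by have := dz i (ltnW ik); rewrite big_ord_recl d0 mul0r add0r.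
pose e l := d l / d ord0.
have ez i : (i < k.+1)%N -> \sum_(l < k.+1) e l * z l ^+ (q ^ i) = 0.
  move=> /dz di; under eq_bigr do rewrite mulrAC.
  by rewrite -mulr_suml di mul0r.
have e0 : e ord0 = 1 by rewrite /e divff.
clearbody e; have e_q l : e l ^+ q = e l.
  case: (unliftP ord0 l) => [j|] ->; last by rewrite e0 expr1n.
  apply/eqP; rewrite -subr_eq0; apply/eqP; move: j.
  apply: IHk (Frobenius_indep_lift (Frobenius_indep_expr indz)) _ => i ik.
  have := ez i.+1 ik; have := ez i (ltnW ik).
  move=> /(congr1 (fun x => x ^+ q)); rewrite exprn_sum_pchar // expr0n gtn_eqF //= mulr0n.
  move=> ei ei1; have /= := congr2 (fun x y => x - y) ei ei1; rewrite subrr => e_i; rewrite -[RHS]e_i.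
  rewrite !big_ord_recl e0 !mul1r -exprM -expnSr opprD addrACA subrr add0r -sumrB.
  by apply: eq_bigr => l' _; rewrite mulrBl exprMn -!exprM -expnS -expnSr.
(* All [e l] are now fixed by the Frobenius, so the relation of exponent [q^0] contradicts
   independence because [e ord0 = 1]. *)
have := indz e e_q _ ord0; rewrite e0 => e10; case/eqP: (oner_neq0 K); apply: e10.
by have := ez 0%N isT; under eq_bigr do rewrite expr1.
Qed.

Lemma moore_det_neq0 k (z : 'I_k -> K) :
  Frobenius_indep z -> \det (\matrix_(i < k, l < k) z l ^+ (q ^ i)) != 0.
Proof.
move=> indz; rewrite -det_tr; apply/det0P=> -[d /eqP d0 dz]; apply: d0.
apply/rowP=> l; rewrite mxE; apply: (moore_relation indz) => i ik.
have /rowP/(_ (Ordinal ik)) := dz; rewrite !mxE => dzi; rewrite -[RHS]dzi.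
by apply: eq_bigr => j _; rewrite !mxE.
Qed.

End Moore.

(** Independence is tested with coefficients in [L] only: by [Frobenius_fixed_fmorph], every
    Frobenius-fixed element of [K] comes from [L]. The map [f] will be the identity or the embedding
    into rational fractions. *)
Lemma moore_det_fmorph_neq0 (L : finFieldType) (q n : nat) (K : fieldType)
    (f : {rmorphism L -> K}) k (z : 'I_k -> K) :
  (1 < q)%N -> #|L| = (q ^ n)%N ->
  (forall c : 'I_k -> L, (forall i, inFq q (c i)) ->
    \sum_(i < k) f (c i) * z i = 0 -> forall i, c i = 0) ->
  \det (\matrix_(i < k, l < k) z l ^+ (q ^ i)) != 0.
Proof.
move=> q1 cardL indz; apply: moore_det_neq0 => [|c cq cz i].
  exact/(pnat_fmorph f)/(pchar_q cardL).
have cL j : {x : L | x ^+ q == x & c j == f x}.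
  apply: sig2W; have [x /eqP xq /eqP cx] := Frobenius_fixed_fmorph q1 cardL f (cq j).
  by exists x.
pose c' j := s2val (cL j).
have c'E j : c j = f (c' j) by apply/eqP/(s2valP' (cL j)).
rewrite c'E (indz c') ?rmorph0 // => [j|].
  exact: (s2valP (cL j)).
by rewrite -[RHS]cz; apply: eq_bigr => j _; rewrite c'E.
Qed.

(** * Lowest-degree components and Moore determinants of polynomials *)

Section LowestDegree.

Variables (L : fieldType) (r : nat).

(* [g] |-> [g (t X)], a polynomial in [t] whose coefficients are the homogeneous
   components of [g]. *)
Definition scaleX : {mpoly L[r]} -> {poly {mpoly L[r]}} :=
  mmap (@polyC _ \o @mpolyC r L) (fun j => ('X_j)%:P * 'X).

HB.instance Definition _ := GRing.RMorphism.copy scaleX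
  (mmap (@polyC _ \o @mpolyC r L) (fun j => ('X_j)%:P * 'X)).

Lemma coef_scaleX g e m : ((scaleX g)`_e)@_m = g@_m *+ (mdeg m == e).
Proof.
have -> : scaleX g = \sum_(m' <- msupp g) (g@_m' *: 'X_[m'])%:P * 'X^(mdeg m').
  apply: eq_bigr => m' _; rewrite /= /mmap1 -mul_mpolyC polyCM -mulrA; congr (_ * _).
  under eq_bigr do rewrite exprMn -polyC_exp.
  by rewrite big_split /= -rmorph_prod -mpolyXE_id prodrXr -mdegE.
rewrite coef_sum raddf_sum /=.
under eq_bigr => m' _.
  rewrite coefCM coefXn mulr_natr raddfMn /= mcoeffZ mcoeffX.
  over.
case: (boolP (m \in msupp g)) => gm.
  rewrite (bigD1_seq m) ?msupp_uniq //= eqxx mulr1 big1 ?addr0 1?eq_sym // => m' m'm.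
  by rewrite (negPf m'm) mulr0 mul0rn.
rewrite memN_msupp_eq0 // mul0rn big1_seq // => m' /andP[_ gm'].
case: eqP => [m'm|_]; first by rewrite -m'm gm' in gm.
by rewrite mulr0 mul0rn.
Qed.

(** The constant coefficient of [G] is the homogeneous component of [g] of degree [d], and the
    factor ['X^d] kills all lower components. *)
Lemma lowest_degree_scaleX g d (G : {poly {mpoly L[r]}}) :
  scaleX g = 'X^d * G -> G`_0 != 0 ->
  (exists mo, mo \in msupp g /\ mdeg mo = d) /\
  (forall mo, mo \in msupp g -> (d <= mdeg mo)%N).
Proof.
move=> gG G0; split; last first.
  move=> mo; rewrite mcoeff_msupp leqNgt; apply: contra => lt_d.
  have := coef_scaleX g (mdeg mo) mo; rewrite eqxx gG coefXnM lt_d mcoeff0 mulr1n.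
  by move=> <-.
have := coef_scaleX g d; rewrite gG coefXnM ltnn subnn => gd.
have [mo] : exists mo, mo \in msupp G`_0.
  move: G0; rewrite -msupp_eq0; case: (msupp _) => // mo s _.
  by exists mo; rewrite mem_head.
rewrite mcoeff_msupp gd; case: (eqVneq (mdeg mo) d) => [<- gmo|_]; last by rewrite eqxx.
by exists mo; rewrite mcoeff_msupp.
Qed.

End LowestDegree.

(** The criterion over fields is applied in the fraction field of the polynomial ring. *)
Lemma moore_det_mpoly_neq0 (L : finFieldType) (q n r k : nat)
    (z : 'I_k -> {mpoly L[r]}) :
  (1 < q)%N -> #|L| = (q ^ n)%N ->
  (forall c : 'I_k -> L, (forall i, inFq q (c i)) ->
    \sum_(i < k) (c i)%:MP * z i = 0 -> forall i, c i = 0) ->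
  \det (\matrix_(i < k, l < k) z l ^+ (q ^ i)) != 0.
Proof.
move=> q1 cardL indz; rewrite -tofrac_eq0 -det_map_mx.
have /= := @moore_det_fmorph_neq0 L q n _ (@tofrac _ \o @mpolyC r L) k
  (fun l => tofrac (z l)) q1 cardL.
set M := (X in _ -> \det X != 0); have -> : map_mx (@tofrac _) (\matrix_(i, l) z l ^+ (q ^ i)) = M.
  by apply/matrixP=> i l; rewrite !mxE rmorphXn.
apply=> c cq cz; apply: indz => //; apply/eqP; rewrite -tofrac_eq0 rmorph_sum.
by apply/eqP; rewrite -[RHS]cz; apply: eq_bigr => i _; rewrite rmorphM.
Qed.

(* With [e = q^(k-1)], scaling the first [k] rows by ['X^-(q^i)], the others by
   ['X^-e] and the last [s] columns by ['X^e] keeps the matrix polynomial and makes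
   it block triangular at ['X = 0]. *)
Lemma moore_det_lowest (L : finFieldType) (q r k s : nat)
    (beta : 'I_(k + s) -> L) (zeta : 'I_(k + s) -> {mpoly L[r]}) :
  (1 < q)%N -> (0 < k)%N -> #|L| = (q ^ (k + s))%N ->
  (forall l, beta (lshift s l) = 0) ->
  (forall c : 'I_s -> L, (forall i, inFq q (c i)) ->
    \sum_(i < s) c i * beta (rshift k i) = 0 -> forall i, c i = 0) ->
  (forall c : 'I_k -> L, (forall i, inFq q (c i)) ->
    \sum_(i < k) (c i)%:MP * zeta (lshift s i) = 0 -> forall i, c i = 0) ->
  exists2 G : {poly {mpoly L[r]}},
    \det (\matrix_(i < k + s, l < k + s)
       ((beta l)%:MP%:P + (zeta l)%:P * 'X) ^+ (q ^ i)) =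
    'X^(\sum_(i < k) q ^ i) * G & G`_0 != 0.
Proof.
move=> q1 k0 cardL beta0 ind_beta ind_zeta.
set E := \matrix_(i, l) _.
pose e := (q ^ k.-1)%N.
pose rho (i : 'I_(k + s)) := (if i < k then q ^ i else e)%N.
pose gam (l : 'I_(k + s)) := (if l < k then 0 else e)%N.
pose E' := \matrix_(i < k + s, l < k + s) if (l < k)%N
  then (zeta l ^+ (q ^ i))%:P * 'X^(q ^ i - rho i) else E i l * 'X^(e - rho i).
have q0 : (0 < q)%N by apply: ltn_trans q1.
(* This bound and [rho_le] make the truncated subtractions in [E'] exact. *)
have rho_le_e i : (rho i <= e)%N.
  by rewrite /rho; case: ifP => // ik; rewrite leq_pexp2l // -ltnS prednK.
have e_lt i : (k <= i)%N -> (e < q ^ i)%N by move=> ki; rewrite ltn_exp2l // prednK.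
have rho_le i : (rho i <= q ^ i)%N.
  by rewrite /rho; case: ltnP => // ki; rewrite ltnW // e_lt.
have pqR : [pchar {poly {mpoly L[r]}}].-nat q.
  exact/(pnat_fmorph (@polyC _ \o @mpolyC r L))/(pchar_q cardL).
have EE' : E *m diag_mx (\row_l 'X^(gam l)) = diag_mx (\row_i 'X^(rho i)) *m E'.
  apply/matrixP=> i l; rewrite mul_mx_diag mul_diag_mx !mxE /gam.
  case: ifP => lk; last by rewrite [RHS]mulrCA -exprD subnKC.
  have -> : beta l = 0.
    by have -> : l = lshift s (Ordinal lk) by apply: val_inj.
  rewrite mpolyC0 add0r mulr1 exprMn mulrCA -exprD subnKC ?rho_le //.
  by rewrite rmorphXn.
have detE : \det E = 'X^(\sum_(i < k) q ^ i) * \det E'.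
  have := congr1 (fun A => \det A) EE'; rewrite !det_mulmx !det_diag.
  under eq_bigr do rewrite mxE; under [X in _ = X * _]eq_bigr do rewrite mxE.
  rewrite !prodrXr !big_split_ord /=.
  have -> : (\sum_(i < k) gam (lshift s i) = 0)%N.
    by apply: big1 => i _; rewrite /gam /= ltn_ord.
  have -> : (\sum_(i < k) rho (lshift s i) = \sum_(i < k) q ^ i)%N.
    by apply: eq_bigr => i _; rewrite /rho /= ltn_ord.
  (* The last [s] rows and the last [s] columns carry the same power of ['X], which cancels. *)
  have -> : (\sum_(i < s) rho (rshift k i) = \sum_(i < s) gam (rshift k i))%N.
    by apply: eq_bigr => i _; rewrite /rho /gam /= ltnNge leq_addr.
  rewrite add0n exprD [\det E * _]mulrC mulrAC [RHS]mulrC => /mulfI; apply.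
  by rewrite expf_eq0 polyX_eq0 andbF.
exists (\det E') => //; rewrite -horner_coef0 -/(horner_eval 0 _) -det_map_mx.
(* At ['X = 0] the diagonal blocks are the Moore matrices of the first [k] values of [zeta] and of
   the [q^k]-th powers of the last [s] values of [beta]. *)
set UL := \matrix_(i < k, l < k) zeta (lshift s l) ^+ (q ^ i).
set LR := \matrix_(i < s, l < s) (beta (rshift k l) ^+ (q ^ k)) ^+ (q ^ i).
have -> : map_mx (horner_eval 0) E' = block_mx UL
    (\matrix_(i < k, l < s) (E' (lshift s i) (rshift k l)).[0]) 0
    (map_mx (@mpolyC r L) LR).
  apply/matrixP=> i l; case: (split_ordP i) => i' ->; case: (split_ordP l) => l' ->.
  - rewrite block_mxEul !mxE /horner_eval /= ltn_ord /rho /= ltn_ord subnn mulr1.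
    by rewrite hornerC.
  - by rewrite block_mxEur !mxE.
  (* In the rows of index at least [k] the exponent [q^i - e] is positive, since [e = q^(k-1)]. *)
  - rewrite block_mxEdl !mxE /horner_eval /= ltn_ord hornerM hornerXn expr0n.
    rewrite /rho /= ltnNge leq_addr /= subn_eq0 leqNgt e_lt ?leq_addr //.
    by rewrite mulr0.
  - rewrite block_mxEdr !mxE /horner_eval /= ltnNge leq_addr /rho /= ltnNge leq_addr /=.
    rewrite subnn mulr1 horner_exp hornerD hornerM !hornerC hornerX.
    by rewrite mulr0 addr0 !rmorphXn /= -exprM -expnD.
rewrite det_ublock det_map_mx mulf_neq0 //.
  exact: moore_det_mpoly_neq0 cardL ind_zeta.
rewrite mpolyC_eq0; apply: (moore_det_fmorph_neq0 (f := idfun) q1 cardL) => c cq cb.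
apply: ind_beta => //; apply/eqP.
(* With coefficients in F_q, a relation between [q^k]-th powers is the [q^k]-th power of a
   relation. *)
suff : (\sum_(i < s) c i * beta (rshift k i)) ^+ (q ^ k) == 0.
  by rewrite expf_eq0 => /andP[].
rewrite (exprq_sum cardL) -[X in _ == X]cb; apply/eqP/eq_bigr=> i _.
by rewrite exprMn (exprn_fixed (eqP (cq i))).
Qed.

(** * The hat embedding *)

(** Subtraction of [s] modulo [N]. With [s = r] and [N = r * n] it sends each block of [r] indices
    to the preceding one, cyclically. *)
Definition rotidx s N (c : 'I_N) : 'I_N :=
  Ordinal (ltn_pmod (c + (N - s)) (leq_ltn_trans (leq0n c) (ltn_ord c))).

Lemma val_iter_rotidx s N i (c : 'I_N) :
  iter i (@rotidx s N) c = ((c + i * (N - s)) %% N)%N :> nat.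
Proof.
elim: i => [|i IHi]; first by rewrite addn0 modn_small.
by rewrite iterS /= IHi modnDml mulSn -addnA [(i * _ + _)%N]addnC.
Qed.

Lemma iter_rotidx s n N : N = (s * n)%N -> iter n (@rotidx s N) =1 id.
Proof.
move=> defN c; apply: val_inj; rewrite /= val_iter_rotidx.
have -> : (n * (N - s) = n.-1 * N)%N by rewrite defN; nia.
by rewrite addnC modnMDl modn_small.
Qed.

Definition cycpred n i := if i is i'.+1 then i' else n.-1.

Lemma val_rotidx r n N (c : 'I_N) i j :
  N = (r * n)%N -> c = (i * r + j)%N :> nat -> (i < n)%N -> (j < r)%N ->
  rotidx r c = (cycpred n i * r + j)%N :> nat.
Proof.
move=> defN ci i_n j_r; rewrite /= ci.
case: i ci i_n => [|i] ci i_n /=.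
  rewrite mul0n add0n modn_small defN; nia.
have -> : (i.+1 * r + j + (N - r) = i * r + j + N)%N by rewrite defN; nia.
rewrite modnDr modn_small // defN; nia.
Qed.

Section Hat.

Variables (L : finFieldType) (q n : nat).
Hypotheses (q_gt1 : (1 < q)%N) (cardL : #|L| = (q ^ n)%N).

Let n_pos : (0 < n)%N := degree_gt0 cardL.

Lemma expr_cycpred (x : L) i : (x ^+ (q ^ cycpred n i)) ^+ q = x ^+ (q ^ i).
Proof.
by case: i => [|i]; rewrite -exprM -expnSr //= prednK // (exprqn cardL) expr1.
Qed.

Lemma inFqD (x y : L) : inFq q x -> inFq q y -> inFq q (x + y).
Proof.
move=> /eqP xq /eqP yq; apply/eqP.
by rewrite exprDn_pchar ?xq ?yq // (pchar_q cardL).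
Qed.

Lemma inFqN (x : L) : inFq q x -> inFq q (- x).
Proof.
by move=> /eqP xq; apply/eqP; rewrite exprNn_pchar ?xq // (pchar_q cardL).
Qed.

Lemma inFqM (x y : L) : inFq q x -> inFq q y -> inFq q (x * y).
Proof. by move=> /eqP xq /eqP yq; rewrite /inFq exprMn xq yq. Qed.

Lemma inFq_sum I (s : seq I) (P : pred I) (F : I -> L) :
  (forall i, inFq q (F i)) -> inFq q (\sum_(i <- s | P i) F i).
Proof.
move=> Fq; apply: (big_ind (inFq q)) => //; last exact: inFqD.
by rewrite /inFq expr0n gtn_eqF // (ltn_trans _ q_gt1).
Qed.

Section Blocks.

Variables (r N : nat).
Hypotheses (r_gt0 : (0 < r)%N) (defN : N = (r * n)%N).

Lemma block_index (c : 'I_N) :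
  exists i : 'I_n, exists j : 'I_r, c = (i * r + j)%N :> nat.
Proof.
have ci : (c %/ r < n)%N by rewrite ltn_divLR // mulnC -defN.
have cj : (c %% r < r)%N by rewrite ltn_mod.
by exists (Ordinal ci), (Ordinal cj); rewrite /= -divn_eq.
Qed.

Lemma block_index_lt (i : 'I_n) (j : 'I_r) : (i * r + j < N)%N.
Proof. by rewrite defN; move: (ltn_ord i) (ltn_ord j); clear; nia. Qed.

Lemma eq_block_index (i i' : nat) (j j' : 'I_r) :
  (i * r + j == i' * r + j')%N = (i == i') && (j == j').
Proof.
apply/eqP/andP=> [e|[/eqP-> /eqP->]] //.
have /(congr1 (fun c => c %/ r)%N) := e; rewrite !divnMDl // !divn_small // !addn0 => ii'.
by split; apply/eqP=> //; apply/val_inj; move: e; rewrite ii' => /addnI.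
Qed.

Lemma hatvE (u : 'rV[L]_r) (i : 'I_n) (j : 'I_r) :
  hatv q n u (i * r + j) = u 0 j ^+ (q ^ i).
Proof.
rewrite /hatv (bigD1 i) //= [X in _ + X]big1 => [|i' i'i].
  rewrite addr0 (big_pred1 j) // => j'.
  by rewrite eq_block_index eqxx eq_sym.
apply: big1 => j'; rewrite eq_block_index => /andP[/eqP ii' _].
by case/eqP: i'i; apply: val_inj.
Qed.

(** The length [N] is only propositionally [r * n]: it is instantiated by [r * n - n + n], and by
    [n] when [r = 1]. *)
Definition hat (u : 'rV[L]_r) : 'rV[L]_N := \row_c hatv q n u c.

Lemma hatE u (c : 'I_N) (i j : nat) : c = (i * r + j)%N :> nat -> (i < n)%N -> forall jr : (j < r)%N,
  hat u 0 c = u 0 (Ordinal jr) ^+ (q ^ i).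
Proof.
by move=> ci i_n jr; rewrite mxE ci (hatvE u (Ordinal i_n) (Ordinal jr)).
Qed.

Lemma cycpred_lt (i : 'I_n) : (cycpred n i < n)%N.
Proof. by case: i => -[|i] i_n //=; [rewrite prednK | apply: ltnW]. Qed.

(** The [q]-th power of each block is the next one; from the last block to the first this is
    [x^(q^n) = x]. *)
Lemma tau_hat u : tau q (@rotidx r N) (hat u) = hat u.
Proof.
apply/rowP=> c; have [i [j ci]] := block_index c; rewrite mxE.
rewrite (hatE u (val_rotidx defN ci (ltn_ord i) (ltn_ord j)) (cycpred_lt i) (ltn_ord j)).
by rewrite expr_cycpred -(hatE u ci (ltn_ord i)).
Qed.

(** The first block determines a fixed vector, each later block being the [q]-th power of the
    preceding one. *)
Lemma tau_fixed_hat (w : 'rV[L]_N) : tau q (@rotidx r N) w = w -> exists u, w = hat u.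
Proof.
move=> tw; exists (\row_j w 0 (Ordinal (block_index_lt (Ordinal n_pos) j))).
apply/rowP=> c; have [[i i_n] [j ci]] := block_index c.
rewrite (hatE _ ci i_n (ltn_ord j)) mxE.
elim: i c i_n ci => [|i IHi] c i_n ci.
  by rewrite expr1; congr (w 0 _); apply/val_inj/ci.
rewrite -{1}tw mxE (IHi _ (ltnW i_n)); first by rewrite -exprM -expnSr.
exact: (val_rotidx defN ci i_n (ltn_ord j)).
Qed.

Lemma hat_sum k (c : 'I_k -> L) (u : 'I_k -> 'rV[L]_r) :
  (forall l, inFq q (c l)) ->
  hat (\sum_(l < k) c l *: u l) = \sum_(l < k) c l *: hat (u l).
Proof.
move=> cq; apply/rowP=> x; have [i [j xi]] := block_index x.
rewrite (hatE _ xi (ltn_ord i) (ltn_ord j)) !summxE (exprq_sum cardL).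
apply: eq_bigr => l _; rewrite [RHS]mxE (hatE _ xi (ltn_ord i) (ltn_ord j)) mxE.
by rewrite exprMn (exprn_fixed (eqP (cq l))).
Qed.

Lemma hatD u u' : hat (u + u') = hat u + hat u'.
Proof.
apply/rowP=> x; have [i [j xi]] := block_index x.
rewrite [RHS]mxE !(hatE _ xi (ltn_ord i) (ltn_ord j)) mxE exprDn_pchar //.
exact: pchar_qX cardL i.
Qed.

Lemma hat0 : hat 0 = 0.
Proof. by apply: (addrI (hat 0)); rewrite -hatD !addr0. Qed.

Lemma hat_eq0 u : hat u = 0 -> u = 0.
Proof.
move=> /rowP hu; apply/rowP=> j; pose c := Ordinal (block_index_lt (Ordinal n_pos) j).
have := hu c; rewrite (@hatE u c 0 j erefl n_pos (ltn_ord j)) expr1 !mxE => <-.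
by congr (u 0 _); apply: val_inj.
Qed.

(** The last [n] rows of the matrix of F_U, taken both at the variables and at the coordinates of
    [v]. *)
Definition blk (R : comNzRingType) (x : 'I_r -> R) : 'M[R]_(n, N) :=
  \matrix_(i < n, c < N) \sum_(j < r | (c : nat) == (i * r + j)%N) x j ^+ (q ^ i).

Lemma blkE (R : comNzRingType) (x : 'I_r -> R) i (c : 'I_N) (i' j : nat) :
  c = (i' * r + j)%N :> nat -> forall jr : (j < r)%N,
  blk x i c = x (Ordinal jr) ^+ (q ^ i) *+ (i' == i).
Proof.
move=> ci jr; rewrite mxE ci.
case: (eqVneq i' i) => [->|i'i].
  rewrite (big_pred1 (Ordinal jr)) // => j'.
  by rewrite (eq_block_index i i (Ordinal jr) j') eqxx /= eq_sym.
rewrite big_pred0 // => j'.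
by rewrite (eq_block_index i' i (Ordinal jr) j') (negPf i'i).
Qed.

(** Row [i] meets only block [i] of [hat (a l)], and the Frobenius turns the resulting sum into a
    power. The product is thus a Moore matrix; [f] covers both constants and polynomials. *)
Lemma blk_mul_hat (R : comNzRingType) (f : {rmorphism L -> R}) (x : 'I_r -> R)
    m (a : 'I_m -> 'rV[L]_r) i l :
  (blk x *m map_mx f (\matrix_l hat (a l))^T) i l =
  (\sum_j x j * f (a l 0 j)) ^+ (q ^ i).
Proof.
have qR : [pchar R].-nat (q ^ i)%N by apply/(pnat_fmorph f)/(pchar_qX cardL).
rewrite mxE exprn_sum_pchar //.
under eq_bigr => c _ do rewrite !mxE mulr_suml.
rewrite (exchange_big_dep predT) //=; apply: eq_bigr => j _.
rewrite (big_pred1 (Ordinal (block_index_lt i j))) => [|c]; last first.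
  by apply/eqP/eqP=> [ci|->] //; apply/val_inj.
by rewrite /= hatvE rmorphXn exprMn.
Qed.

Lemma equivariant_blk (x : 'I_r -> L) :
  equivariant q (@rotidx 1 n) (@rotidx r N) (blk x).
Proof.
move=> i c; have [i' [j ci]] := block_index c.
rewrite (blkE _ _ ci (ltn_ord j)).
rewrite (blkE _ _ (val_rotidx defN ci (ltn_ord i') (ltn_ord j)) (ltn_ord j)).
have ri : rotidx 1 i = cycpred n i :> nat.
  by rewrite (@val_rotidx 1 n n i i 0) ?mul1n ?muln1 ?addn0.
rewrite ri; case: (eqVneq i' i) => [<-|i'i]; first by rewrite !eqxx !mulr1n expr_cycpred.
rewrite (inj_eq val_inj) (negPf i'i) (_ : (cycpred n _ == _) = false) ?mulr0n ?expr0n.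
  by rewrite gtn_eqF // (ltn_trans _ q_gt1).
apply: contraNF i'i => /eqP; case: i' {ci} => -[|i'] i'n; case: i {ri} => -[|i] i_n //=;
  move=> ii'; apply/eqP/val_inj => /=; lia.
Qed.

Lemma powers_mul_blk (v : 'rV[L]_r) (lam : L) :
  (\row_(i < n) lam ^+ (q ^ i)) *m blk (v 0) = hat (lam *: v).
Proof.
apply/rowP=> c; have [i [j ci]] := block_index c.
rewrite mxE (hatE _ ci (ltn_ord i) (ltn_ord j)) mxE exprMn (bigD1 i) //=.
rewrite (blkE _ _ ci (ltn_ord j)) eqxx mxE big1 ?addr0 // => i' i'i.
by rewrite (blkE _ _ ci (ltn_ord j)) (inj_eq val_inj) eq_sym (negPf i'i) mulr0.
Qed.

End Blocks.

(** The case [r = 1] of the hat embedding. *)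
Lemma tau_fixed_powers (w : 'rV[L]_n) :
  tau q (@rotidx 1 n) w = w -> exists lam, w = \row_i lam ^+ (q ^ i).
Proof.
move=> /(tau_fixed_hat (ltnSn 0) (esym (mul1n n)))[u ->]; exists (u 0 0); apply/rowP=> i.
rewrite (@hatE 1 n isT u i i 0) ?muln1 ?addn0 // mxE; congr (u 0 _ ^+ _).
exact: val_inj.
Qed.

Lemma tau_powers (lam : L) :
  tau q (@rotidx 1 n) (\row_(i < n) lam ^+ (q ^ i)) = \row_(i < n) lam ^+ (q ^ i).
Proof.
apply/rowP=> i; rewrite !mxE (@val_rotidx 1 n n i i 0) ?mul1n ?muln1 ?addn0 //.
exact: expr_cycpred.
Qed.

End Hat.

(** * A basis of the orthogonal of U adapted to v *)

Section AdaptedBasis.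

Variables (L : finFieldType) (q n r : nat).
Hypotheses (q_gt1 : (1 < q)%N) (cardL : #|L| = (q ^ n)%N) (r_gt0 : (0 < r)%N).

Local Notation M := (r * n - n)%N.
Local Notation N := (r * n - n + n)%N.

Let defN : N = (r * n)%N. Proof. by rewrite subnK // leq_pmull. Qed.
Let n_pos : (0 < n)%N := degree_gt0 cardL.

Variables (b : 'I_M -> 'rV[L]_r) (v : 'rV[L]_r) (k : nat).
Hypotheses (indb : Fq_indep q b) (v_neq0 : v != 0) (wk : weight q b v k).

Let B : 'M[L]_(M, N) := \matrix_a hat q n N (b a).
Let X : 'M[L]_(n, N) := blk q n N (v 0).
(** The matrix of F_U evaluated at [v]; its corank will be the weight [k]. *)
Let Y : 'M[L]_N := col_mx B X.

(** With this shift, the [tau]-fixed vectors are an F_q-vector on the rows of [B] followed by the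
    powers [lam^(q^i)] on the rows of [X]. *)
Definition kershift (i : 'I_N) : 'I_N :=
  match split i with inl a => lshift n a | inr c => rshift M (rotidx 1 c) end.

Lemma kershift_lshift a : kershift (lshift n a) = lshift n a.
Proof. by rewrite /kershift (unsplitK (inl a)). Qed.

Lemma kershift_rshift c : kershift (rshift M c) = rshift M (rotidx 1 c).
Proof. by rewrite /kershift (unsplitK (inr c)). Qed.

Lemma iter_kershift : iter n kershift =1 id.
Proof.
move=> i; case: (split_ordP i) => c ->.
  have it m : iter m kershift (lshift n c) = lshift n c.
    by elim: m => //= m ->; rewrite kershift_lshift.
  exact: it.
have it m : iter m kershift (rshift M c) = rshift M (iter m (@rotidx 1 n) c).
  by elim: m => //= m ->; rewrite kershift_rshift.
by rewrite it (iter_rotidx (esym (mul1n n))).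
Qed.

Lemma tau_kershift (d : 'rV[L]_M) (e : 'rV[L]_n) :
  tau q kershift (row_mx d e) = row_mx (tau q id d) (tau q (@rotidx 1 n) e).
Proof.
apply/rowP=> i; rewrite mxE; case: (split_ordP i) => c ->.
  by rewrite kershift_lshift !row_mxEl mxE.
by rewrite kershift_rshift !row_mxEr mxE.
Qed.

Lemma equivariant_Y : equivariant q kershift (@rotidx r N) Y.
Proof.
move=> i c; case: (split_ordP i) => i' ->.
  rewrite kershift_lshift !col_mxEu mxE -{1}(tau_hat cardL r_gt0 defN) mxE.
  by rewrite [B _ _]mxE.
by rewrite kershift_rshift !col_mxEd; apply: equivariant_blk.
Qed.

Lemma hat_free m (a : 'I_m -> 'rV[L]_r) :
  Fq_indep q a -> row_free (\matrix_i hat q n N (a i)).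
Proof.
move=> inda; apply: (row_free_tau_fixed q_gt1 cardL (pi := @rotidx r N)) => [i|d dq da].
  by rewrite rowK tau_hat.
apply/rowP=> i; rewrite mxE; apply: (inda (d 0)) => //.
apply: (hat_eq0 cardL r_gt0 defN); rewrite (hat_sum cardL) //.
rewrite -[RHS]da mulmx_sum_row; by apply: eq_bigr => j _; rewrite rowK.
Qed.

Lemma mul_row_Y (d : 'I_M -> L) lam : (forall a, inFq q (d a)) ->
  row_mx (\row_a d a) (\row_(i < n) lam ^+ (q ^ i)) *m Y =
  hat q n N (\sum_a d a *: b a + lam *: v).
Proof.
move=> dq; rewrite mul_row_col powers_mul_blk // (hatD cardL) // (hat_sum cardL) //.
by congr (_ + _); rewrite mulmx_sum_row; apply: eq_bigr => a _; rewrite rowK mxE.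
Qed.

(* The tau-fixed vectors of the left kernel of [Y] are the pairs of F_q-coordinates
   on [b] and [lam] with [lam *: v] in U, so this kernel descends to <v> :&: U. *)
Lemma rank_ker_Y : \rank (kermx Y) = k.
Proof.
have [w [Ww [indw spanw]]] := wk.
have [lam wlam] := fin_all_exists (fun i => proj1 (Ww i)).
have [D wD] := fin_all_exists (fun i => proj2 (Ww i)).
have Dq i a : inFq q (D i a) by case: (wD i).
have {}wD i : w i = \sum_a D i a *: b a by case: (wD i).
(* Row [i] records the two expressions of [w i], as [lam i *: v] and on [b]; the sign puts it in the
   left kernel of [Y]. *)
pose G : 'M[L]_(k, N) := \matrix_i row_mx (\row_a - D i a) (\row_(j < n) lam i ^+ (q ^ j)).
have freeG : row_free G.
  apply: (row_free_tau_fixed q_gt1 cardL (pi := kershift)) => [i|d dq dG].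
    rewrite rowK tau_kershift (tau_powers cardL); congr row_mx; apply/rowP=> a.
    by rewrite !mxE; apply/eqP/(inFqN cardL).
  apply/rowP=> i; rewrite mxE; apply: (indw (d 0)) => //.
  (* The entry of exponent [q^0] says that the [lam i] satisfy the relation [d]. *)
  have /rowP/(_ (rshift M (Ordinal n_pos))) := dG; rewrite mulmx_sum_row summxE mxE => d0.
  under eq_bigr do rewrite wlam scalerA.
  rewrite -scaler_suml (_ : \sum_i _ = 0) ?scale0r // -[RHS]d0.
  by apply: eq_bigr => j _; rewrite rowK mxE row_mxEr mxE expr1.
have GY : (G <= kermx Y)%MS.
  apply/row_subP=> i; apply/sub_kermxP; rewrite rowK.
  rewrite (mul_row_Y (d := fun a => - D i a)); last by move=> a; apply/(inFqN cardL).
  under eq_bigr do rewrite scaleNr; rewrite sumrN -wD -wlam addNr.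
  exact: (hat0 cardL r_gt0 defN).
have stabY := fun x => kermx_tau q_gt1 cardL iter_kershift equivariant_Y (w := x).
have [F [tF freeF FY]] := tau_fixed_basis q_gt1 cardL iter_kershift stabY erefl.
(* Conversely a fixed kernel vector gives [l *: v] in U; by independence of [b], its F_q-coordinates
   on [w] express the vector on the rows of [G]. *)
have FG : (F <= G)%MS.
  apply/row_subP=> i; move: (tF i); have /sub_kermxP := submx_trans (row_sub i F) FY.
  rewrite -[row i F]hsubmxK tau_kershift; move: (lsubmx _) (rsubmx _) => d e Yde.
  case/eq_row_mx=> dq /(tau_fixed_powers cardL)[l def_e].
  have {}dq a : inFq q (d 0 a) by have /rowP/(_ a) := dq; rewrite mxE => /eqP.
  have defd : d = \row_a d 0 a by apply/rowP=> a; rewrite mxE.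
  move: Yde; rewrite def_e {1}defd mul_row_Y // => /(hat_eq0 cardL r_gt0 defN) dbv.
  have lv : l *: v = \sum_a (- d 0 a) *: b a.
    under eq_bigr do rewrite scaleNr; apply/eqP.
    by rewrite sumrN -addr_eq0 addrC dbv.
  have [c [cq lc]] : Fq_span q w (l *: v).
    apply/spanw; split; first by exists l.
    by exists (fun a => - d 0 a); split=> // a; apply/(inFqN cardL).
  have l_c : l = \sum_i c i * lam i.
    apply/eqP; rewrite -subr_eq0; have : (l - \sum_i c i * lam i) *: v = 0.
      rewrite scalerBl lc scaler_suml; apply/eqP; rewrite subr_eq0; apply/eqP/eq_bigr=> j _.
      by rewrite wlam scalerA.
    by move/eqP; rewrite scaler_eq0 (negPf v_neq0) orbF.
  have d_c a : d 0 a + \sum_i c i * D i a = 0.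
    move: a; apply: indb => [a|].
      by apply: (inFqD cardL) => //; apply: (inFq_sum q_gt1 cardL) => j; apply: inFqM.
    rewrite -[RHS]dbv lc; under eq_bigr do rewrite scalerDl scaler_suml.
    rewrite big_split exchange_big /=; congr (_ + _); apply: eq_bigr => j _.
    by rewrite wD scaler_sumr; apply: eq_bigr => a _; rewrite scalerA.
  apply/submxP; exists (\row_j c j); rewrite mulmx_sum_row.
  apply/rowP=> x; rewrite summxE; case: (split_ordP x) => y ->.
    rewrite row_mxEl; apply/eqP; rewrite -subr_eq0 -sumrN -[X in _ == X](d_c y).
    apply/eqP; congr (_ + _); apply: eq_bigr => j _.
    by rewrite rowK !mxE (unsplitK (inl y)) mxE mulrN opprK.
  rewrite row_mxEr mxE l_c (exprq_sum cardL); apply: eq_bigr => j _.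
  by rewrite rowK !mxE (unsplitK (inr y)) mxE exprMn (exprn_fixed (eqP (cq j))).
apply/eqP; rewrite eqn_leq -{2}(eqP freeG) (mxrankS GY) andbT -(eqP freeG).
by rewrite -{1}(eqP freeF) (mxrankS FG).
Qed.

(** Since [hat b *m (hat a)^T] is the trace of [b . a], the fixed vectors of [kermx B^T] are the
    hats of the trace-orthogonal of U. Those in [kermx Y^T] also satisfy [a . v = 0]; a fixed basis
    of [kermx Y^T] is extended to one of [kermx B^T]. *)
Lemma adapted_dual_basis :
  exists s, n = (k + s)%N /\ exists a : 'I_(k + s) -> 'rV[L]_r,
    [/\ Fq_indep q a, B *m (\matrix_l hat q n N (a l))^T = 0,
        forall l, \sum_j v 0 j * a (lshift s l) 0 j = 0 &
        forall c : 'I_s -> L, (forall l, inFq q (c l)) ->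
          \sum_l c l * (\sum_j v 0 j * a (rshift k l) 0 j) = 0 -> forall l, c l = 0].
Proof.
have piN := iter_rotidx defN.
have eqYT : equivariant q (@rotidx r N) kershift Y^T.
  by move=> c i; rewrite ![Y^T _ _]mxE; apply: equivariant_Y.
have eqBT : equivariant q (@rotidx r N) id B^T.
  by move=> c i; have := equivariant_Y (lshift n i) c; rewrite kershift_lshift !col_mxEu ![B^T _ _]mxE.
(* [Y] is square, so its left and right kernels have the same dimension. *)
have rY : \rank (kermx Y^T) = k by rewrite mxrank_ker mxrank_tr -mxrank_ker rank_ker_Y.
have rB : \rank (kermx B^T) = n.
  by rewrite mxrank_ker mxrank_tr (eqP (hat_free indb)) addKn.
have YB : (kermx Y^T <= kermx B^T)%MS.
  apply/sub_kermxP; have := mulmx_ker Y^T; rewrite {2}/Y tr_col_mx mul_mx_row.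
  by rewrite -[X in _ = X -> _]row_mx0 => /eq_row_mx[].
have stabY := fun x => kermx_tau q_gt1 cardL piN eqYT (w := x).
have stabB := fun x => kermx_tau q_gt1 cardL piN eqBT (w := x).
have [A1 [tA1 freeA1 A1Y]] := tau_fixed_basis q_gt1 cardL piN stabY rY.
have A1B := submx_trans A1Y YB.
have kn : (k <= n)%N by have := mxrankS A1B; rewrite rB (eqP freeA1).
exists (n - k)%N; split; first by rewrite subnKC.
move: (n - k)%N (subnKC kn) => s kns.
have [|A2 [tA2 freeA AB]] := tau_fixed_basis_extend q_gt1 cardL piN stabB A1B freeA1 (s := s).
  by rewrite rB kns.
have hatA l : exists a : 'rV[L]_r, row l (col_mx A1 A2) = hat q n N a.
  apply: (tau_fixed_hat cardL r_gt0 defN).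
  by case: (split_ordP l) => l' ->; rewrite ?rowKu ?rowKd.
have [a Aa] := fin_all_exists hatA; exists a.
have defA : \matrix_l hat q n N (a l) = col_mx A1 A2.
  by apply/row_matrixP=> l; rewrite rowK Aa.
have va i l : (X *m (\matrix_l hat q n N (a l))^T) i l = (\sum_j v 0 j * a l 0 j) ^+ (q ^ i).
  have := blk_mul_hat cardL r_gt0 defN idfun (v 0) a i l.
  by rewrite map_mx_id //.
have XA1 : X *m A1^T = 0.
  apply: trmx_inj; rewrite trmx_mul trmxK trmx0.
  have /sub_kermxP := A1Y; rewrite /Y tr_col_mx mul_mx_row.
  by rewrite -[X in _ = X -> _]row_mx0 => /eq_row_mx[].
split.
- move=> c cq ca; have : (\row_l c l) *m col_mx A1 A2 = 0.
    rewrite -defA mulmx_sum_row; under eq_bigr do rewrite rowK mxE.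
    by rewrite -(hat_sum cardL) // ca (hat0 cardL).
  move=> cA l; have /rowP/(_ l) : \row_l c l = 0 by apply: (row_free_inj freeA); rewrite mul0mx.
  by rewrite !mxE.
- by rewrite defA; apply: trmx_inj; rewrite trmx_mul trmxK trmx0; apply/sub_kermxP.
- move=> l; have := va (Ordinal n_pos) (lshift s l); rewrite expr1 => <-.
  by rewrite defA tr_col_mx mul_mx_row row_mxEl XA1 mxE.
move=> c cq cv.
(* A relation [c] puts a combination of the rows of [A2] in [kermx Y^T], which is spanned by [A1];
   freeness of the joint family makes it trivial. *)
have cA2 : (\row_l c l) *m A2 = hat q n N (\sum_l c l *: a (rshift k l)).
  rewrite (hat_sum cardL) // mulmx_sum_row; apply: eq_bigr => l _.
  by rewrite mxE -Aa rowKd.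
have cA2Y : ((\row_l c l) *m A2 <= kermx Y^T)%MS.
  apply/sub_kermxP; rewrite /Y tr_col_mx mul_mx_row.
  rewrite -[RHS]row_mx0; congr row_mx.
    have := AB; rewrite col_mx_sub => /andP[_ /sub_kermxP A2B].
    by rewrite -mulmxA A2B mulmx0.
  apply/rowP=> i; rewrite cA2; pose a0 (_ : 'I_1) := \sum_l c l *: a (rshift k l).
  have := blk_mul_hat cardL r_gt0 defN idfun (v 0) a0 i 0.
  rewrite map_mx_id // => vai.
  transitivity ((X *m (\matrix_l hat q n N (a0 l))^T) i 0).
    rewrite -[in RHS](trmxK X) -trmx_mul [RHS]mxE.
    by congr (fun_of_matrix (mulmx _ _)); apply/rowP=> x; rewrite !mxE.
  rewrite vai [RHS]mxE (_ : \sum_j _ = 0).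
    by rewrite expr0n gtn_eqF // expn_gt0 (ltn_trans _ q_gt1).
  rewrite -[RHS]cv; under [RHS]eq_bigr do rewrite mulr_sumr.
  rewrite exchange_big; apply: eq_bigr => j _; rewrite /a0 /= summxE mulr_sumr.
  by apply: eq_bigr => l _; rewrite mxE mulrCA.
have /submxP[d cd] : ((\row_l c l) *m A2 <= A1)%MS.
  apply: (submx_trans cA2Y); rewrite -(mxrank_leqif_sup A1Y).2 rY.
  by rewrite (eqP freeA1).
have : row_mx (- d) (\row_l c l) *m col_mx A1 A2 = 0.
  by rewrite mul_row_col mulNmx cd addNr.
move=> dcA; have : row_mx (- d) (\row_l c l) = 0.
  by apply: (row_free_inj freeA); rewrite mul0mx.
by rewrite -[X in _ = X -> _]row_mx0 => /eq_row_mx[_ /rowP c0] l; have := c0 l; rewrite !mxE.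
Qed.

End AdaptedBasis.

(** * F_U as a Moore determinant, and its expansion at [v] *)

Lemma detpoly_mul_det (L : finFieldType) (q n r : nat)
    (b : 'I_(r * n - n) -> 'rV[L]_r) (a : 'I_n -> 'rV[L]_r)
    (B := \matrix_i hat q n (r * n - n + n) (b i))
    (A := \matrix_l hat q n (r * n - n + n) (a l)) :
  #|L| = (q ^ n)%N -> (0 < r)%N -> row_free B -> B *m A^T = 0 ->
  detpoly q b * (\det (row_mx (pinvmx B) A^T))%:MP =
  \det (\matrix_(i < n, l < n) (\sum_j 'X_j * (a l 0 j)%:MP) ^+ (q ^ i)).
Proof.
move=> cardL r0 freeB BA.
have defN : (r * n - n + n = r * n)%N by rewrite subnK // leq_pmull.
have -> : detpoly q b = \det (col_mx (map_mx (@mpolyC r L) B)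
    (blk q n (r * n - n + n) (fun j => 'X_j))).
  by congr (\det (col_mx _ _)); apply/matrixP=> i c; rewrite !mxE.
(* As [pinvmx B] is a right inverse of [B] and [B *m A^T = 0], the product is block lower triangular
   with an identity block and a Moore block. *)
rewrite -det_map_mx -det_mulmx map_row_mx mul_col_row -!map_mxM BA (mulmxVp freeB).
rewrite map_mx0 map_mx1 det_lblock det1 mul1r; congr (\det _).
apply/matrixP=> i l; rewrite [RHS]mxE.
exact: (blk_mul_hat cardL r0 defN (@mpolyC r L) (fun j => 'X_j) a i l).
Qed.

(** The coordinate [i0] is the constant 1 on the chart, so it contributes to the constant term but
    not to the linear part. *)
Lemma linear_form_chart (L : fieldType) (r : nat) (w a : 'rV[L]_r) (i0 : 'I_r) :
  w 0 i0 = 1 ->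
  scaleX ((\sum_j 'X_j * (a 0 j)%:MP) \mPo
    [tuple (if j == i0 then 1 else 'X_j + (w 0 j)%:MP) | j < r]) =
  (\sum_j w 0 j * a 0 j)%:MP%:P +
  (\sum_j (if j == i0 then 0 else 'X_j) * (a 0 j)%:MP)%:P * 'X.
Proof.
move=> w1; rewrite [X in scaleX X](rmorph_sum (comp_mpoly _)) !rmorph_sum mulr_suml -big_split.
apply: eq_bigr => j _.
rewrite !rmorphM /= comp_mpolyXU comp_mpolyC -tnth_nth tnth_mktuple.
have sC c : scaleX (c%:MP : {mpoly L[r]}) = c%:MP%:P by rewrite /scaleX mmapC.
case: eqP => [->|_]; first by rewrite w1 !rmorph1 rmorph0 !mul0r addr0 !mul1r sC.
rewrite rmorphD /= !sC {1}/scaleX mmapX mmap1U addrC mulrDl.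
by rewrite mulrAC.
Qed.

Theorem mainTheorem2 (L : finFieldType) (q n r : nat)
    (b : 'I_(r * n - n) -> 'rV[L]_r) (v : 'rV[L]_r) (k : nat) :
  (1 < q)%N -> (2 <= n)%N -> (2 <= r)%N -> #|L| = (q ^ n)%N ->
  Fq_indep q b ->
  v != 0 -> weight q b v k -> (2 <= k)%N ->
  forall i0 : 'I_r, v 0 i0 != 0 ->
    mult_at (detpoly q b) v i0 (\sum_(i < k) q ^ i)%N.
Proof.
move=> q1 _ r2 cardL indb v0 wk k2 i0 vi0.
have r0 : (0 < r)%N by apply: ltnW.
have freeB := hat_free q1 cardL r0 indb.
have [s [def_n [a [inda BA va0 indva]]]] := adapted_dual_basis q1 cardL r0 indb v0 wk.
subst n; rewrite /mult_at; set w := _ *: v; set chart := [tuple _ | _ < r].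
have w1 : w 0 i0 = 1 by rewrite mxE mulVf.
have := detpoly_mul_det cardL r0 freeB BA; set detQ := \det (row_mx _ _) => detpolyE.
pose beta l := \sum_j w 0 j * a l 0 j.
pose zeta l : {mpoly L[r]} := \sum_j (if j == i0 then 0 else 'X_j) * (a l 0 j)%:MP.
have betaE l : beta l = (v 0 i0)^-1 * \sum_j v 0 j * a l 0 j.
  by rewrite mulr_sumr; apply: eq_bigr => j _; rewrite mxE mulrA.
have [||||||G detG G0] := @moore_det_lowest L q r k s beta zeta.
- by [].
- exact: ltnW.
- by [].
- by move=> l; rewrite betaE va0 mulr0.
- move=> c cq cb; apply: indva => //; apply: (mulfI (invr_neq0 vi0)).
  rewrite mulr0 -[RHS]cb mulr_sumr; apply: eq_bigr => l _.
  by rewrite betaE mulrCA.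
(* The linear parts forget the coordinate [i0]: a relation makes [u] vanish elsewhere, and
   [v . u = 0] with [v 0 i0 != 0] kills that last coordinate. *)
- move=> c cq cz; pose u := \sum_l c l *: a (lshift s l).
  have zu : \sum_j (if j == i0 then 0 else 'X_j) * (u 0 j)%:MP = 0 :> {mpoly L[r]}.
    rewrite -[RHS]cz; under [RHS]eq_bigr do rewrite mulr_sumr.
    rewrite exchange_big; apply: eq_bigr => j _.
    rewrite summxE rmorph_sum mulr_sumr; apply: eq_bigr => l _.
    by rewrite mxE rmorphM /= mulrCA.
  have uj j : j != i0 -> u 0 j = 0.
    move=> ji0; have := congr1 (mcoeff U_(j)) zu; rewrite mcoeff0 raddf_sum /= => zuj.
    rewrite -[RHS]zuj (bigD1 j) //= (negPf ji0) mulrC mul_mpolyC mcoeffZ mcoeffX eqxx mulr1.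
    rewrite big1 ?addr0 // => j' j'j; rewrite mulrC mul_mpolyC mcoeffZ.
    by case: ifP => _; rewrite ?mcoeff0 ?mcoeffXU ?(negPf j'j) mulr0.
  have vu : \sum_j v 0 j * u 0 j = 0.
    rewrite (eq_bigr (fun j => \sum_l c l * (v 0 j * a (lshift s l) 0 j))).
      rewrite exchange_big big1 // => l _.
      by rewrite -mulr_sumr va0 mulr0.
    by move=> j _; rewrite summxE mulr_sumr; apply: eq_bigr => l _; rewrite mxE mulrCA.
  have u0 : u = 0.
    apply/rowP=> j; rewrite [RHS]mxE; have [->|/uj //] := eqVneq j i0.
    apply/eqP; move: vu; rewrite (bigD1 i0) //= big1 ?addr0 => [/eqP|j' /uj ->].
      by rewrite mulf_eq0 (negPf vi0).
    by rewrite mulr0.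
  (* Extension by zero, to use the independence of the whole family [a]. *)
  pose c' (x : 'I_(k + s)) := if split x is inl l then c l else 0.
  have c'l l : c' (lshift s l) = c l by rewrite /c' (unsplitK (inl l)).
  have c'r l : c' (rshift k l) = 0 by rewrite /c' (unsplitK (inr l)).
  move=> l; rewrite -c'l; apply: inda => [x|].
    rewrite /c'; case: split => // _.
    by rewrite /inFq expr0n gtn_eqF // (ltn_trans _ q1).
  rewrite big_split_ord /= [X in _ + X]big1 ?addr0 => [|j _]; last by rewrite c'r scale0r.
  by rewrite -[RHS]u0; apply: eq_bigr => j _; rewrite c'l.
have scaled : scaleX (detpoly q b \mPo chart) * detQ%:MP%:P = 'X^(\sum_(i < k) q ^ i) * G.
  have <- : scaleX (detQ%:MP \mPo chart) = detQ%:MP%:P by rewrite comp_mpolyC /scaleX mmapC.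
  rewrite -!rmorphM detpolyE -detG -!det_map_mx; congr (\det _).
  by apply/matrixP=> i l; rewrite !mxE !rmorphXn /= linear_form_chart.
(* Were this scalar zero, [scaled] would force [G = 0], against its nonzero constant coefficient. *)
have detQ0 : detQ != 0.
  apply: contraNneq G0 => dQ0; move/eqP: scaled.
  rewrite dQ0 mpolyC0 mulr0 eq_sym mulf_eq0 expf_eq0 polyX_eq0 andbF /= => /eqP->.
  by rewrite coef0.
apply: (lowest_degree_scaleX (G := (detQ^-1)%:MP%:P * G)).
  by rewrite mulrCA -scaled mulrCA -polyCM -mpolyCM mulVf // mulr1.
by rewrite coefCM mulf_neq0 // mpolyC_eq0 invr_eq0.
Qed.
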